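(* Let $\bar z\in\Omega$ and assume that there exists $u\in L^\infty([0,T];\mathbb{R}^m)$ such that $$c(t)+\sum_{i\in I_0(t)}u_i(t)a_i(t)=0\ \text{ for a.e. } t\in[0,T],$$ $$u_i(t)\ge 0\ \text{ for a.e. } t\in[0,T],\ i\in I.$$ Then $\bar z$ is an optimal solution of (CLP).
   Context: Setting: $T>0$, and $A:[0,T]\to\mathbb{R}^{m\times n}$, $b:[0,T]\to\mathbb{R}^m$, $c:[0,T]\to\mathbb{R}^n$ have measurable, essentially bounded entries. Let $I=\{1,\dots,m\}$ and let $a_i(t)^\top$ be the $i$-th row of $A(t)$. Problem (CLP): minimize $F(z)=\int_0^T c(t)^\top z(t)\,dt$ over the feasible set $\Omega=\{z\in L^\infty([0,T];\mathbb{R}^n): A(t)z(t)\le b(t)\text{ a.e. in }[0,T]\}$ (inequalities componentwise). $\bar z\in\Omega$ is an optimal solution if $F(\bar z)\le F(z)$ for all $z\in\Omega$. Given $\bar z\in\Omega$, $I_0(t)=\{i\in I: a_i(t)^\top\bar z(t)-b_i(t)=0\}$ (active constraints). *)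

(* Defs.v *)
From mathcomp Require Import all_boot all_order all_algebra.
From mathcomp Require Import all_classical all_reals all_analysis.
Import Order.TTheory GRing.Theory Num.Theory.
Import numFieldNormedType.Exports.

Set Implicit Arguments.
Unset Strict Implicit.
Unset Printing Implicit Defensive.

Local Open Scope classical_set_scope.
Local Open Scope ring_scope.

(* A function on [0, T] is represented by a function on the whole line, of
   which only the values on [0, T] matter: the predicate below extends the
   restriction of f by 0, and every condition is imposed a.e. on [0, T].
   completed_lebesgue_measure is used so that "measurable" means Lebesgue
   measurable, not just Borel measurable. *)
Definition Linfty_mx (R : realType) (T : R) (p q : nat)
    (f : R -> 'M[R]_(p, q)) : Prop :=
  forall (i : 'I_p) (j : 'I_q),
    ((fun t => f t i j) \_ `[0, T]) \in Lfun (@completed_lebesgue_measure R) +oo%E.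

(* For c, z in L^infty the integrand is integrable, so that the real-valued
   integral is the genuine Lebesgue integral. *)
Definition CLP_objective (R : realType) (T : R) (n : nat)
    (c z : R -> 'cV[R]_n) : R :=
  (\int[@completed_lebesgue_measure R]_(t in `[0, T]) (((c t)^T *m z t) 0 0))%R.

Definition CLP_feasible (R : realType) (T : R) (m n : nat)
    (A : R -> 'M[R]_(m, n)) (b : R -> 'cV[R]_m) : set (R -> 'cV[R]_n) :=
  [set z | Linfty_mx T z /\
     {ae @completed_lebesgue_measure R, forall t, t \in `[0, T] ->
        forall i : 'I_m, (A t *m z t) i 0 <= b t i 0}].

Definition CLP_optimal (R : realType) (T : R) (m n : nat)
    (A : R -> 'M[R]_(m, n)) (b : R -> 'cV[R]_m) (c zbar : R -> 'cV[R]_n)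
    : Prop :=
  CLP_feasible T A b zbar /\
  forall z, CLP_feasible T A b z ->
    CLP_objective T c zbar <= CLP_objective T c z.

Definition active_set (R : realType) (m n : nat)
    (A : R -> 'M[R]_(m, n)) (b : R -> 'cV[R]_m) (zbar : R -> 'cV[R]_n)
    (t : R) : {set 'I_m} :=
  [set i : 'I_m | (row i (A t) *m zbar t) 0 0 - b t i 0 == 0]%SET.

(* Main.v *)
(* At almost every t, pair c(t) = - sum_{i in I0(t)} u_i(t) a_i(t) with zbar(t)
   and with a feasible z(t): since a_i . zbar = b_i >= a_i . z on I0(t) and
   u_i >= 0, this gives c . zbar <= c . z, which is then integrated. *)
Require Import Defs.
From mathcomp Require Import all_boot all_order all_algebra.
From mathcomp Require Import all_classical all_reals all_analysis.
From mathcomp Require Import ess_sup_inf measurable_realfun.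
Import Order.TTheory GRing.Theory Num.Theory.
Import numFieldNormedType.Exports.

Local Open Scope classical_set_scope.
Local Open Scope ring_scope.

Lemma Lfuny_ae_bounded d (X : measurableType d) (R : realType)
    (mu : {measure set X -> \bar R}) (f : X -> R) :
  f \in Lfun mu +oo%E -> exists M : R, {ae mu, forall x, `|f x| <= M}.
Proof.
move=> /sub_Lfun_finLfun; rewrite inE /= /finite_norm unlock /=.
case: ifPn => [_|muX _]; first exact: ess_supr_bounded.
(* When [mu setT] is 0, the norm carries no information on [f], but the whole space is negligible,
   so any bound holds a.e. *)
exists 0; exists setT; split => //.
by apply/eqP; rewrite eq_le measure_ge0 andbT leNgt.
Qed.

Lemma ae_bounded_integrable d (X : measurableType d) (R : realType)
    (mu : {measure set X -> \bar R}) (D : set X) (f : X -> R) (M : R) :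
  measurable D -> (mu D < +oo)%E -> measurable_fun D f ->
  {ae mu, forall x, D x -> `|f x| <= M} -> mu.-integrable D (EFin \o f).
Proof.
move=> mD muD mf fM; apply/integrableP; split; first exact/measurable_EFinP.
(* The dominating constant is [|M|] because comparison of integrals requires nonnegative functions,
   and [M] may be negative when [D] is null. *)
apply: (@le_lt_trans _ _ (\int[mu]_(x in D) (cst `|M|%:E) x)%E).
  apply: ae_ge0_le_integral => //.
  - by apply: measurableT_comp => //; exact/measurable_EFinP.
  - by move=> x _; rewrite lee_fin.
  - apply: filterS fM => x fM Dx.
    by rewrite lee_fin (le_trans (fM Dx))// ler_norm.
by rewrite integral_cst// lte_mul_pinfty.
Qed.

Lemma ae_le_Rintegral d (X : measurableType d) (R : realType)
    (mu : {measure set X -> \bar R}) (D : set X) (f g : X -> R) :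
  measurable D -> mu.-integrable D (EFin \o f) ->
  mu.-integrable D (EFin \o g) -> {ae mu, forall x, D x -> f x <= g x} ->
  \int[mu]_(x in D) f x <= \int[mu]_(x in D) g x.
Proof.
move=> mD intf intg fg; rewrite -subr_ge0 -RintegralB//.
have mfg : measurable_fun D (fun x => g x - f x).
  by apply: measurable_funB; apply/measurable_EFinP; apply: measurable_int;
    eassumption.
(* Nonnegativity of [g - f] is known only a.e.; replacing it by its absolute value, to which it is
   a.e. equal, gives an integrand that is nonnegative everywhere. *)
rewrite /Rintegral (ae_eq_integral (fun x => `|g x - f x|%:E))//.
- by rewrite fine_ge0// integral_ge0.
- exact/measurable_EFinP.
- by apply/measurable_EFinP; exact: measurableT_comp.
- by apply: filterS fg => x fg Dx; rewrite ger0_norm// subr_ge0 fg.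
Qed.

Lemma completed_lebesgue_measure_itv_lty (R : realType) (a b : R) :
  (@completed_lebesgue_measure R `[a, b]%classic < +oo)%E.
Proof.
have : (@lebesgue_measure R `[a, b]%classic < +oo)%E.
  by rewrite lebesgue_measure_itv /=; case: ifP => _; rewrite ?ltry.
(* both measures restrict the same outer measure, hence are convertible *)
exact.
Qed.

(** [completed_lebesgue_measure] lives on the Carathéodory sigma-algebra of the outer measure, which
    contains the Borel sets. *)
Lemma measurable_completed_itv (R : realType) (i : interval R) :
  (@wlength R idfun)^*%mu.-cara.-measurable [set` i].
Proof. by apply: sub_caratheodory; exact: measurable_itv. Qed.

Lemma Linfty_mx_measurable (R : realType) (T : R) (p q : nat)
    (f : R -> 'M[R]_(p, q)) (i : 'I_p) (j : 'I_q) : Linfty_mx T f ->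
  measurable_fun (`[0, T] : set (caratheodory_type (@wlength R idfun)^*%mu))
    (fun t => f t i j).
Proof.
move=> /(_ i j) /sub_Lfun_mfun; rewrite inE /= => mf.
by apply/measurable_restrictT; first exact: measurable_completed_itv.
Qed.

Lemma Linfty_mx_ae_bounded (R : realType) (T : R) (p q : nat)
    (f : R -> 'M[R]_(p, q)) (i : 'I_p) (j : 'I_q) : Linfty_mx T f ->
  exists M : R, {ae @completed_lebesgue_measure R, forall t,
    t \in `[0, T] -> `|f t i j| <= M}.
Proof.
move=> /(_ i j) /Lfuny_ae_bounded[M fM]; exists M.
by apply: filterS fM => t; rewrite patchE => + tT; rewrite ifT// inE.
Qed.

(** The integrand is a finite sum of products of essentially bounded entries, and a bounded
    measurable function is integrable on an interval of finite measure. *)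
Lemma Linfty_mx_dot_integrable (R : realType) (T : R) (n : nat)
    (c z : R -> 'cV[R]_n) : Linfty_mx T c -> Linfty_mx T z ->
  (@completed_lebesgue_measure R).-integrable `[0, T]
    (EFin \o (fun t => ((c t)^T *m z t) 0 0)).
Proof.
move=> hc hz.
have mD := measurable_completed_itv R `[0, T].
have -> : EFin \o (fun t => ((c t)^T *m z t) 0 0) =
    (fun t => \sum_(j < n) (c t j 0 * z t j 0)%:E)%E.
  by apply/funext => t /=; rewrite sumEFin mxE; under eq_bigr do rewrite mxE.
apply: integrable_sum => // j _.
have [M cM] := Linfty_mx_ae_bounded _ _ _ _ _ j 0 hc.
have [N zN] := Linfty_mx_ae_bounded _ _ _ _ _ j 0 hz.
apply: (@ae_bounded_integrable _ _ _ _ _ _ (M * N)) => //.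
- exact: completed_lebesgue_measure_itv_lty.
- by apply: measurable_funM; exact: Linfty_mx_measurable.
- near=> t => tT.
  by rewrite normrM ler_pM//; [exact: (near cM t)|exact: (near zN t)].
Unshelve. all: by end_near. Qed.

(** This is the pointwise part of the argument, with [t] frozen: pure linear algebra, where [I]
    stands for the active set, [x] for [zbar t] and [y] for the competitor. *)
Lemma kkt_le (R : realDomainType) (m n : nat) (A : 'M[R]_(m, n))
    (b u : 'cV[R]_m) (c x y : 'cV[R]_n) (I : {set 'I_m}) :
  c + \sum_(i in I) u i 0 *: (row i A)^T = 0 ->
  (forall i, i \in I -> 0 <= u i 0) ->
  (forall i, i \in I -> (A *m x) i 0 = b i 0) ->
  (forall i, i \in I -> (A *m y) i 0 <= b i 0) ->
  (c^T *m x) 0 0 <= (c^T *m y) 0 0.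
Proof.
move=> /eqP; rewrite addr_eq0 => /eqP cE u_ge0 Ax Ay.
(* Stated for arbitrary [w], so that it rewrites both sides of the goal into sums over [I] that
   compare term by term. *)
have cw (w : 'cV[R]_n) :
    (c^T *m w) 0 0 = - \sum_(i in I) u i 0 * (A *m w) i 0.
  rewrite cE linearN /= linear_sum /= mulNmx mulmx_suml mxE summxE.
  congr (- _); apply: eq_bigr => i _.
  by rewrite linearZ /= trmxK -scalemxAl mxE -row_mul mxE.
rewrite !cw lerN2; apply: ler_sum => i iI.
by rewrite ler_wpM2l ?u_ge0// Ax// Ay.
Qed.

Theorem theorem3p3 (R : realType) (T : R) (hT : 0 < T) (m n : nat)
    (A : R -> 'M[R]_(m, n)) (b : R -> 'cV[R]_m) (c : R -> 'cV[R]_n)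
    (hA : Linfty_mx T A) (hb : Linfty_mx T b) (hc : Linfty_mx T c)
    (zbar : R -> 'cV[R]_n) (hzbar : CLP_feasible T A b zbar)
    (hu : exists u : R -> 'cV[R]_m,
       [/\ Linfty_mx T u,
           {ae @completed_lebesgue_measure R, forall t, t \in `[0, T] ->
              c t + \sum_(i in active_set A b zbar t)
                      u t i 0 *: (row i (A t))^T = 0}
         & forall i : 'I_m,
           {ae @completed_lebesgue_measure R, forall t, t \in `[0, T] ->
              0 <= u t i 0}]) :
  CLP_optimal T A b c zbar.
Proof.
split=> // z [hz Az]; have [hzb _] := hzbar; have [u [_ cu u_ge0]] := hu.
apply: ae_le_Rintegral.
- exact: measurable_completed_itv.
- exact: Linfty_mx_dot_integrable.
- exact: Linfty_mx_dot_integrable.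
(* Each index comes with its own exceptional null set; as there are finitely many indices, a single
   null set serves them all. *)
have {}u_ge0 : {ae @completed_lebesgue_measure R, forall t i,
    t \in `[0, T] -> 0 <= u t i 0}.
  exact: filter_forall.
near=> t => tT.
apply: (@kkt_le _ _ _ (A t) (b t) (u t) _ _ _ (active_set A b zbar t)).
- exact: (near cu t).
- by move=> i _; exact: (near u_ge0 t).
(* Membership in the active set is phrased with the row product [row i (A t) *m zbar t], which is
   the [i]-th entry of [A t *m zbar t]. *)
- by move=> i; rewrite inE -row_mul mxE subr_eq0 => /eqP.
- by move=> i _; exact: (near Az t).
Unshelve. all: by end_near. Qed.
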